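(* Let $\omega=e^{2\pi i/5}$ and $\alpha=e^{2\pi i/3}$. Let $F_5=\frac{1}{\sqrt5}\left(\omega^{jk}\right)_{j,k=0}^{4}$ be the $5\times 5$ Fourier matrix, let $D=\mathrm{diag}(1,\omega,\omega^4,\omega^4,\omega)$, and let $H_j=D^jF_5$ for $j=1,2,3,4$. Let $S_{15}$ be the complex Hadamard matrix of order $15$ given by $$S_{15}=\frac{1}{\sqrt{3}}\begin{pmatrix} F_5 & H_3 & H_4\\ H_1^{\dagger}F_5 & \alpha H_1^{\dagger}H_3 & \alpha^2H_1^{\dagger}H_4\\ H_2^{\dagger}F_5 & \alpha^2H_2^{\dagger}H_3 & \alpha H_2^{\dagger}H_4\end{pmatrix}.$$ Then $S_{15}$ is inequivalent to the Fourier family $F_{15}^{(8)}$ and to the transposed Fourier family $(F_{15}^{(8)})^T$; that is, $S_{15}$ is not equivalent to any complex Hadamard matrix belonging to $F_{15}^{(8)}$ or to $(F_{15}^{(8)})^T$.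
   Context: A complex Hadamard matrix of order $d$ is a $d\times d$ unitary complex matrix all of whose elements have equal modulus (hence modulus $1/\sqrt d$); $\dagger$ denotes the conjugate transpose. Two complex Hadamard matrices $H$ and $K$ of the same order are equivalent if $H=D_1P_1KP_2D_2$ for some diagonal matrices $D_1,D_2$ whose diagonal elements are phase factors (complex numbers of modulus one) and some permutation matrices $P_1,P_2$; otherwise they are inequivalent. Fourier families: let $F_{15}=\frac{1}{\sqrt{15}}\left(e^{2\pi i jk/15}\right)_{j,k=0}^{14}$ be the $15\times15$ Fourier matrix. The eight-parameter affine Fourier family $F_{15}^{(8)}$ stemming from $F_{15}$ is the set of all complex Hadamard matrices $F_{15}\circ \mathrm{EXP}(iR)$, where $\circ$ denotes the entrywise product, $\mathrm{EXP}$ the entrywise exponential, and $R=(R_{jk})_{j,k=0}^{14}$ ranges over the real matrices of the form $R_{jk}=r(j \bmod 3,\; k \bmod 5)$, with $r:\{0,1,2\}\times\{0,1,2,3,4\}\to\mathbb{R}$ satisfying $r(0,b)=0$ for all $b$ and $r(a,0)=0$ for all $a$ (leaving $2\cdot 4=8$ free real parameters). The transposed Fourier family is $(F_{15}^{(8)})^T=\{H^T : H\in F_{15}^{(8)}\}$. *)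

(* Defs.v *)
From mathcomp Require Import all_boot all_order all_algebra.
From mathcomp Require Import spectral complex.
From mathcomp Require Import classical_sets reals trigo.
From mathcomp Require Import ring lra zify.

Set Implicit Arguments.
Unset Strict Implicit.
Unset Printing Implicit Defensive.

Import Order.TTheory GRing.Theory Num.Theory.
Local Open Scope ring_scope.
Local Open Scope complex_scope.
Local Open Scope sesquilinear_scope.

Definition complex_hadamard (R : realType) (d : nat) (H : 'M[R[i]]_d) : Prop :=
  H \is unitarymx /\ forall i j k l, `|H i j| = `|H k l|.

Definition phase_diag (R : realType) (d : nat) (D : 'M[R[i]]_d) : Prop :=
  exists2 u : 'rV[R[i]]_d, (forall j, `|u 0 j| = 1) & D = diag_mx u.

Definition hadamard_equiv (R : realType) (d : nat) (H K : 'M[R[i]]_d) : Prop :=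
  exists D1 D2 P1 P2 : 'M[R[i]]_d,
    [/\ phase_diag D1, phase_diag D2, is_perm_mx P1, is_perm_mx P2
      & H = D1 *m P1 *m K *m P2 *m D2].

(* e^(i t), for t real *)
Definition expi (R : realType) (t : R) : R[i] := cos t +i* sin t.

Definition zeta (R : realType) (n : nat) : R[i] := expi (2 * pi / n%:R).

Definition fourier_mx (R : realType) (n : nat) : 'M[R[i]]_n :=
  (sqrtC n%:R)^-1 *: \matrix_(j < n, k < n) zeta R n ^+ (j * k).

Definition F15_phase (R : realType) (r : 'M[R]_(3, 5)) : 'M[R]_15 :=
  \matrix_(j < 15, k < 15) r (inord (j %% 3)) (inord (k %% 5)).

(* every such product is complex Hadamard, by F15_family_hadamard *)
Definition F15_family (R : realType) : set 'M[R[i]]_15 :=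
  [set H | exists r : 'M[R]_(3, 5),
     [/\ forall b, r ord0 b = 0, forall a, r a ord0 = 0
       & H = map2_mx *%R (fourier_mx R 15)
                         (map_mx (@expi R) (F15_phase r))]]%classic.
Arguments F15_family : clear implicits.

Definition F15_family_tr (R : realType) : set 'M[R[i]]_15 :=
  [set H^T | H in F15_family R]%classic.
Arguments F15_family_tr : clear implicits.

Definition S15_D (R : realType) : 'M[R[i]]_5 :=
  let w := zeta R 5 in
  diag_mx (\row_(j < 5) nth 0 [:: 1; w; w ^+ 4; w ^+ 4; w] j).

Definition S15_H (R : realType) (j : nat) : 'M[R[i]]_5 :=
  S15_D R ^+ j *m fourier_mx R 5.

(* 3 x 3 blocks of order 5, with 'M_(5 + (5 + 5)) convertible to 'M_15;
   complex Hadamard by S15_hadamard *)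
Definition S15 (R : realType) : 'M[R[i]]_15 :=
  let a := zeta R 3 in
  let F5 := fourier_mx R 5 in
  let H := S15_H R in
  ((sqrtC 3)^-1 *:
    col_mx (row_mx F5
           (row_mx (H 3)
                   (H 4)))
   (col_mx (row_mx ((H 1) ^t* *m F5)
           (row_mx (a *: ((H 1) ^t* *m H 3))
                   (a ^+ 2 *: ((H 1) ^t* *m H 4))))
           (row_mx ((H 2) ^t* *m F5)
           (row_mx (a ^+ 2 *: ((H 2) ^t* *m H 3))
                   (a *: ((H 2) ^t* *m H 4)))))
   : 'M_(5 + (5 + 5))).

Section Facts.
Context (R : realType).
Implicit Types (t : R) (n : nat).

Lemma expi0 : expi (0 : R) = 1.
Proof. by rewrite /expi cos0 sin0. Qed.

Lemma expiD t u : expi (t + u) = expi t * expi u.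
Proof. by rewrite /expi cosD sinD; simpc; congr (_ +i* _); rewrite addrC. Qed.

Lemma conj_expi t : Num.conj (expi t) = expi (- t).
Proof. by rewrite /expi cosN sinN. Qed.

Lemma expi_conj t : expi t * Num.conj (expi t) = 1.
Proof. by rewrite conj_expi -expiD subrr expi0. Qed.

Lemma expiX t n : expi t ^+ n = expi (t *+ n).
Proof.
elim: n => [|n IH]; first by rewrite mulr0n expi0.
by rewrite exprS IH mulrS expiD.
Qed.

Lemma norm_expi t : `|expi t| = 1.
Proof. by apply/eqP; rewrite -sqrp_eq1 ?normr_ge0 // normCK expi_conj. Qed.

Lemma zetaX n : (0 < n)%N -> zeta R n ^+ n = 1.
Proof.
move=> n0; rewrite /zeta expiX -[_ *+ n]mulr_natr mulfVK ?pnatr_eq0 -?lt0n //.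
by rewrite /expi mulr_natl cos2pi sin2pi.
Qed.

Lemma zeta_prim n : (0 < n)%N -> n.-primitive_root (zeta R n).
Proof.
move=> n0; have [m pm mn] := prim_order_exists n0 (zetaX n0).
suff emn : m = n by rewrite -{1}emn.
have m0 := prim_order_gt0 pm.
move: (dvdn_leq n0 mn); rewrite leq_eqVlt => /orP[/eqP//|ltmn].
have := prim_expr_order pm; rewrite /zeta expiX => -[] c1 _; exfalso.
pose h : R := pi * (m%:R / n%:R).
have hE : 2 * pi / n%:R *+ m = h *+ 2.
  by rewrite /h -mulr_natr -[RHS]mulr_natl; ring.
move: c1; rewrite hE cos_mulr2n cos2sin2 => c1.
have s0 : 0 < sin h.
  apply: sin_gt0_pi; rewrite ?in_itv /= ?mulr_gt0 ?pi_gt0 ?invr_gt0 ?ltr0n //=.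
  rewrite -[ltRHS]mulr1 ltr_pM2l ?pi_gt0 //.
  by rewrite ltr_pdivrMr ?ltr0n // mul1r ltr_nat.
have : sin h ^+ 2 > 0 by rewrite exprn_gt0.
by move: c1; rewrite mulr2n; lra.
Qed.

Lemma conj_zeta n : Num.conj (zeta R n) = (zeta R n)^-1.
Proof.
apply: (mulfI (x := zeta R n)); first by rewrite -normr_eq0 norm_expi oner_eq0.
by rewrite expi_conj mulfV // -normr_eq0 norm_expi oner_eq0.
Qed.

Lemma norm_zetaX n k : `|zeta R n ^+ k| = 1.
Proof. by rewrite normrX norm_expi expr1n. Qed.

Lemma zeta_neq0 n : zeta R n != 0.
Proof. by rewrite -normr_eq0 norm_expi oner_eq0. Qed.

Lemma root_sum (x : R[i]) n : x ^+ n = 1 -> x != 1 -> \sum_(k < n) x ^+ k = 0.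
Proof.
move=> xn x1; apply: (mulfI (x := x - 1)); first by rewrite subr_eq0.
by rewrite -subrX1 xn subrr mulr0.
Qed.

Lemma sqrtC_inv2 n : (sqrtC n%:R : R[i])^-1 * (sqrtC n%:R)^-1 = n%:R^-1.
Proof. by rewrite -invfM -expr2 sqrtCK. Qed.

Lemma conj_sqrtV n : Num.conj (sqrtC n%:R : R[i])^-1 = (sqrtC n%:R)^-1.
Proof. by rewrite geC0_conj // invr_ge0 sqrtC_ge0 ler0n. Qed.

Lemma F15_family_hadamard K : F15_family R K -> complex_hadamard K.
Proof.
move=> [r [_ _ ->]]; set w := zeta R 15; split; last first.
  by move=> i j k l; rewrite !mxE !normrM !norm_zetaX !norm_expi.
have w15 : w ^+ 15 = 1 by apply: zetaX.
apply/unitarymxP/matrixP=> j j'; rewrite !mxE.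
pose z := w ^+ j / w ^+ j'.
pose f (k : nat) := expi (r (inord (j %% 3)) (inord (k %% 5)) -
   r (inord (j' %% 3)) (inord (k %% 5))).
transitivity (15%:R^-1 * \sum_(k < 15) z ^+ k * f k).
  rewrite mulr_sumr; apply: eq_bigr => k _; rewrite !mxE -sqrtC_inv2 /z /f.
  rewrite expiD -conj_expi !rmorphM /= conj_sqrtV rmorphXn /= conj_zeta.
  by rewrite -/w expr_div_n -!exprM -exprVn; ring.
have zX d : (z ^+ d == 1) = (d * j == d * j' %[mod 15]).
  rewrite -(eq_prim_root_expr (zeta_prim (isT : (0 < 15)%N))) -/w.
  rewrite expr_div_n -!exprM !(mulnC _ d).
  by rewrite (can2_eq (divfK _) (mulfK _)) ?mul1r // expf_neq0 ?zeta_neq0.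
have z15 : z ^+ 15 = 1 by apply/eqP; rewrite zX !modnMr.
have [ejj|njj] := eqVneq (j %% 3)%N (j' %% 3)%N.
  have f1 k : f k = 1 by rewrite /f ejj subrr expi0.
  under eq_bigr do rewrite f1 mulr1.
  have := zX 1%N; rewrite expr1 !mul1n !modn_small // => z1.
  have [ej|nj] := eqVneq j j'; last by rewrite root_sum ?mulr0 // z1.
  have /eqP -> : z == 1 by rewrite z1 ej.
  under eq_bigr do rewrite expr1n.
  by rewrite sumr_const card_ord mulVf // pnatr_eq0.
have -> : (j == j') = false by apply: contraNF njj => /eqP->.
have z5 : z ^+ 5 != 1.
  by rewrite zX -!(muln_modr 5 _ 3) eqn_mul2l.
have z3 : 1 + z ^+ 5 + z ^+ 10 = 0.
  have := root_sum (n := 3) (x := z ^+ 5).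
  rewrite -exprM z15 => /(_ erefl z5).
  by rewrite !big_ord_recr big_ord0 /= add0r expr0 expr1 -exprM.
rewrite !big_ord_recr big_ord0 /= add0r.
have fP k : f k = f (k %% 5)%N by rewrite /f modn_mod.
rewrite (fP 5%N) (fP 6%N) (fP 7%N) (fP 8%N) (fP 9%N) (fP 10%N) (fP 11%N).
rewrite (fP 12%N) (fP 13%N) (fP 14%N).
transitivity ((15%:R^-1 * (1 + z ^+ 5 + z ^+ 10)) *
  (f 0%N + z * f 1%N + z ^+ 2 * f 2%N + z ^+ 3 * f 3%N + z ^+ 4 * f 4%N)).
  by ring.
by rewrite z3 mulr0 mul0r.
Qed.

Lemma F15_family_tr_hadamard K : F15_family_tr R K -> complex_hadamard K.
Proof.
move=> [H /F15_family_hadamard[uH nH] <-]; split; first by rewrite trmx_unitary.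
by move=> i j k l; rewrite !mxE.
Qed.

Lemma fourier5_unitary : fourier_mx R 5 \is unitarymx.
Proof.
set w := zeta R 5; have w5 : w ^+ 5 = 1 by apply: zetaX.
apply/unitarymxP/matrixP=> j j'; rewrite !mxE.
pose z := w ^+ j / w ^+ j'.
transitivity (5%:R^-1 * \sum_(k < 5) z ^+ k).
  rewrite mulr_sumr; apply: eq_bigr => k _; rewrite !mxE -sqrtC_inv2 /z.
  rewrite !rmorphM /= conj_sqrtV rmorphXn /= conj_zeta.
  by rewrite -/w expr_div_n -!exprM -exprVn; ring.
have z5 : z ^+ 5 = 1.
  by rewrite expr_div_n -!exprM !(mulnC _ 5) !exprM w5 !expr1n divr1.
have z1 : (z == 1) = (j == j').
  rewrite (can2_eq (divfK _) (mulfK _)) ?expf_neq0 ?zeta_neq0 // mul1r.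
  by rewrite (eq_prim_root_expr (zeta_prim _)) // !modn_small.
have [ej|nj] := eqVneq j j'; last by rewrite root_sum ?mulr0 // z1.
have /eqP -> : z == 1 by rewrite z1 ej.
under eq_bigr do rewrite expr1n.
by rewrite sumr_const card_ord mulVf // pnatr_eq0.
Qed.

(* S15_D = diag (w ^ S15_expo l) *)
Definition S15_expo (l : nat) : nat := nth 0%N [:: 0; 1; 4; 4; 1]%N l.

Lemma S15_HE j (l m : 'I_5) :
  S15_H R j l m = (sqrtC 5%:R)^-1 * zeta R 5 ^+ (S15_expo l * j + l * m).
Proof.
have DE : S15_D R = diag_mx (\row_(l < 5) zeta R 5 ^+ S15_expo l).
  rewrite /S15_D; congr diag_mx; apply/rowP => k; rewrite !mxE.
  by case: k => -[|[|[|[|[|//]]]]].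
rewrite /S15_H; have -> : S15_D R ^+ j = diag_mx (\row_(l < 5) zeta R 5 ^+ (S15_expo l * j)).
  elim: j => [|j IH].
    rewrite expr0 -[1]/(1%:M) -diag_const_mx; congr diag_mx.
    by apply/rowP => k; rewrite !mxE muln0.
  rewrite exprS IH DE -[_ * _]/(_ *m _) mulmx_diag; congr diag_mx.
  by apply/rowP => k; rewrite !mxE mulnS exprD.
by rewrite mul_diag_mx !mxE exprD; ring.
Qed.

Lemma S15_H_unitary j : S15_H R j \is unitarymx.
Proof.
apply: mul_unitarymx fourier5_unitary.
have D1 : S15_D R \is unitarymx.
  apply/unitarymxP; rewrite /S15_D tr_diag_mx map_diag_mx mulmx_diag.
  rewrite -diag_const_mx; congr diag_mx; apply/rowP => k; rewrite !mxE.
  case: k => -[|[|[|[|[|//]]]]] _ /=;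
    by rewrite -normCK ?norm_zetaX ?normr1 ?norm_expi expr1n.
elim: j => [|j IH]; last by rewrite exprS; exact: mul_unitarymx D1 IH.
by apply/unitarymxP; rewrite expr0 trmx1 map_mx1 mulmx1.
Qed.

Lemma gauss5 (K n : nat) : (K %% 5 != 0)%N ->
  `|\sum_(l < 5) zeta R 5 ^+ (S15_expo l * K + l * n)| = sqrtC 5%:R.
Proof.
set w := zeta R 5; have w5 : w ^+ 5 = 1 by apply: zetaX.
have w4 : w ^+ 4 = - (1 + w + w ^+ 2 + w ^+ 3).
  have w1 : w != 1 by rewrite -[w]expr1 -(prim_order_dvd (zeta_prim (n := 5) _)).
  have := root_sum w5 w1; rewrite !big_ord_recr big_ord0 /= expr0 expr1 => s.
  by apply/eqP; rewrite -subr_eq0; apply/eqP; rewrite -[RHS]s; ring.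
move=> K0; have wm e : w ^+ e = w ^+ (e %% 5) by rewrite expr_mod.
have qE l : w ^+ (S15_expo l * K + l * n) = w ^+ ((S15_expo l * (K %% 5) + l * (n %% 5)) %% 5).
  by rewrite wm -modnDm -modnMmr -[(l * n %% 5)%N]modnMmr modnDm.
under eq_bigr do rewrite qE.
move: (K %% 5)%N (n %% 5)%N K0 (ltn_pmod K (isT : 0 < 5)%N)
  (ltn_pmod n (isT : 0 < 5)%N) => {qE}K' n' K0 K5 n5.
apply/eqP; rewrite -(eqrXn2 (n := 2)) ?sqrtC_ge0 ?ler0n // sqrtCK normCK.
rewrite rmorph_sum /=.
have cE e : Num.conj (w ^+ (e %% 5)) = w ^+ ((4 * e) %% 5).
  rewrite -!wm rmorphXn /= conj_zeta exprM; congr (_ ^+ _).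
  by apply: (mulfI (zeta_neq0 5)); rewrite mulfV ?zeta_neq0 // -exprS.
under [X in _ * X]eq_bigr do rewrite cE.
rewrite !big_ord_recr !big_ord0 /=.
case: K' K0 K5 => [|[|[|[|[|//]]]]] // _ _;
case: n' n5 => [|[|[|[|[|//]]]]] // _. 
all: repeat match goal with |- context [modn ?a 5] =>
  let v := eval compute in (modn a 5) in change (modn a 5) with v end.
all: apply/eqP; rewrite ?expr0 ?expr1.
all: ring: w4.
Qed.

Lemma norm_S15_block a b (i m : 'I_5) : ((4 * a + b) %% 5 != 0)%N ->
  `|((S15_H R a) ^t* *m S15_H R b) i m| = (sqrtC 5%:R)^-1.
Proof.
move=> ab; rewrite mxE.
transitivity `|5%:R^-1 * \sum_(l < 5)
    zeta R 5 ^+ (S15_expo l * (4 * a + b) + l * (4 * i + m))|.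
  congr `|_|; rewrite mulr_sumr; apply: eq_bigr => l _.
  have trE (A : 'M[R[i]]_5) : (A ^t*) i l = Num.conj (A l i) by rewrite !mxE.
  rewrite -sqrtC_inv2 trE !S15_HE !rmorphM /= conj_sqrtV rmorphXn /= conj_zeta.
  have -> : (zeta R 5)^-1 = zeta R 5 ^+ 4.
    by apply: (mulfI (zeta_neq0 5)); rewrite mulfV ?zeta_neq0 // -exprS zetaX.
  rewrite -exprM mulrACA -exprD; congr (_ * _ ^+ _); lia.
rewrite normrM gauss5 // normfV normr_nat -sqrtC_inv2.
by rewrite mulfVK // sqrtC_eq0 pnatr_eq0.
Qed.

Lemma norm_col_mx3 (V : numDomainType) (v : V) p
  (A B D : 'M[V]_(5, p)) :
  (forall i j, `|A i j| = v) -> (forall i j, `|B i j| = v) ->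
  (forall i j, `|D i j| = v) ->
  forall i j, `|col_mx A (col_mx B D) i j| = v.
Proof.
move=> hA hB hD i j; rewrite mxE; case: split => k; first exact: hA.
by rewrite mxE; case: split.
Qed.

Lemma norm_row_mx3 (V : numDomainType) (v : V) p
  (A B D : 'M[V]_(p, 5)) :
  (forall i j, `|A i j| = v) -> (forall i j, `|B i j| = v) ->
  (forall i j, `|D i j| = v) ->
  forall i j, `|row_mx A (row_mx B D) i j| = v.
Proof.
move=> hA hB hD i j; rewrite mxE; case: split => k; first exact: hA.
by rewrite mxE; case: split.
Qed.

Lemma S15_H0 : S15_H R 0 = fourier_mx R 5.
Proof. by rewrite /S15_H expr0 mul1mx. Qed.

Lemma block3_unitary p (c : R[i]) (A1 A2 A3 B1 B2 B3 D1 D2 D3 : 'M[R[i]]_p) :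
  let dot (X1 X2 X3 Y1 Y2 Y3 : 'M[R[i]]_p) :=
    X1 *m Y1 ^t* + (X2 *m Y2 ^t* + X3 *m Y3 ^t*) in
  let k := c * Num.conj c in
  k *: dot A1 A2 A3 A1 A2 A3 = 1%:M -> k *: dot B1 B2 B3 B1 B2 B3 = 1%:M ->
  k *: dot D1 D2 D3 D1 D2 D3 = 1%:M -> dot A1 A2 A3 B1 B2 B3 = 0 ->
  dot A1 A2 A3 D1 D2 D3 = 0 -> dot B1 B2 B3 A1 A2 A3 = 0 ->
  dot B1 B2 B3 D1 D2 D3 = 0 -> dot D1 D2 D3 A1 A2 A3 = 0 ->
  dot D1 D2 D3 B1 B2 B3 = 0 ->
  c *: col_mx (row_mx A1 (row_mx A2 A3)) (col_mx (row_mx B1 (row_mx B2 B3))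
    (row_mx D1 (row_mx D2 D3))) \is unitarymx.
Proof.
move=> dot k AA BB DD AB AD BA BD DA DB; apply/unitarymxP.
rewrite linearZ /= map_mxZ /= -scalemxAl -scalemxAr scalerA -/k.
rewrite !(tr_col_mx, tr_row_mx, map_col_mx, map_row_mx).
rewrite !mul_col_row /block_mx mul_mx_row !mul_col_mx !mul_row_col.
rewrite -/(dot A1 A2 A3 A1 A2 A3) -/(dot A1 A2 A3 B1 B2 B3).
rewrite -/(dot A1 A2 A3 D1 D2 D3) -/(dot B1 B2 B3 A1 A2 A3).
rewrite -/(dot B1 B2 B3 B1 B2 B3) -/(dot B1 B2 B3 D1 D2 D3).
rewrite -/(dot D1 D2 D3 A1 A2 A3) -/(dot D1 D2 D3 B1 B2 B3).
rewrite -/(dot D1 D2 D3 D1 D2 D3) AB AD BA BD DA DB.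
by rewrite !(scale_col_mx, scale_row_mx) AA BB DD !scaler0 row_mx0 col_mx0
  !scalar_mx_block.
Qed.

Lemma G_unitary j : (S15_H R j) ^t* \is unitarymx.
Proof. by rewrite trmxC_unitary S15_H_unitary. Qed.

Lemma S15_gen_unitary p (A2 A3 K1 K2 K3 : 'M[R[i]]_p) :
  A2 \is unitarymx -> A3 \is unitarymx ->
  K1 \is unitarymx -> K2 \is unitarymx -> K3 \is unitarymx ->
  forall a, a = zeta R 3 ->
  (sqrtC 3%:R)^-1 *: col_mx (row_mx K1 (row_mx K2 K3))
    (col_mx (row_mx (A2 *m K1)
                    (row_mx (a *: (A2 *m K2)) (a ^+ 2 *: (A2 *m K3))))
            (row_mx (A3 *m K1)
                    (row_mx (a ^+ 2 *: (A3 *m K2)) (a *: (A3 *m K3)))))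
  \is unitarymx.
Proof.
move=> /unitarymxP hA2 /unitarymxP hA3 /unitarymxP hK1 /unitarymxP hK2.
move=> /unitarymxP hK3 a aE.
have a3 : a ^+ 3 = 1 by rewrite aE zetaX.
have aK : a * Num.conj a = 1 by rewrite aE expi_conj.
have a0 : 1 + a + a ^+ 2 = 0.
  have a1 : a != 1.
    by rewrite aE -[zeta R 3]expr1 -(prim_order_dvd (zeta_prim (n := 3) _)).
  have := root_sum a3 a1.
  by rewrite !big_ord_recr big_ord0 /= expr0 expr1 add0r.
have a4 : a ^+ 4 = a by rewrite exprS a3 mulr1.
have cA : Num.conj a = a ^+ 2.
  by apply: (mulfI (zeta_neq0 3)); rewrite -aE -exprS a3 aK.
have blockE (x y : R[i]) (A B K : 'M[R[i]]_p) : K *m K ^t* = 1%:M ->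
    (x *: (A *m K)) *m (y *: (B *m K)) ^t* = (x * Num.conj y) *: (A *m B ^t*).
  move=> KK; rewrite linearZ /= map_mxZ /= trmx_mul map_mxM /=.
  rewrite -scalemxAl -scalemxAr scalerA; congr (_ *: _).
  by rewrite mulmxA -(mulmxA A) KK mulmx1.
have II : 1%:M *m (1%:M : 'M[R[i]]_p) ^t* = 1%:M by rewrite trmx1 map_mx1 mulmx1.
have n3 : (3%:R^-1 : R[i]) * 3%:R = 1 by rewrite mulVf // pnatr_eq0.
have aE2 : a ^+ 2 = - 1 - a.
  by apply/eqP; rewrite -subr_eq0; apply/eqP; rewrite -[RHS]a0; ring.
rewrite (_ : col_mx _ _ =
  col_mx (row_mx (1 *: (1%:M *m K1)) (row_mx (1 *: (1%:M *m K2))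
                                             (1 *: (1%:M *m K3))))
 (col_mx (row_mx (1 *: (A2 *m K1)) (row_mx (a *: (A2 *m K2))
                                           (a ^+ 2 *: (A2 *m K3))))
         (row_mx (1 *: (A3 *m K1)) (row_mx (a ^+ 2 *: (A3 *m K2))
                                           (a *: (A3 *m K3))))));
  last by rewrite !scale1r !mul1mx.
apply: block3_unitary.
all: rewrite !blockE //.
all: rewrite -!scalerDl ?II ?hA2 ?hA3 ?scalerA ?conj_sqrtV ?sqrtC_inv2.
all: rewrite ?rmorphXn ?rmorph1 /= ?cA.
1-3: apply: etrans (scale1r _); congr (_ *: _); rewrite -[RHS]n3; congr (_ * _).
4-9: apply: etrans (scale0r _); congr (_ *: _).
all: rewrite -?[_%:A]/(_ * 1).
all: by ring: aE2.

Qed.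

Lemma norm_S15 i j : `|S15 R i j| = (sqrtC 3%:R)^-1 * (sqrtC 5%:R)^-1.
Proof.
rewrite mxE normrM normfV (ger0_norm (x := sqrtC 3%:R)); last first.
  by rewrite sqrtC_ge0 ler0n.
congr (_ * _).
move: i j; rewrite -S15_H0.
have n0 a (i j : 'I_5) : `|S15_H R a i j| = (sqrtC 5%:R)^-1.
  by rewrite S15_HE normrM norm_zetaX mulr1 normfV ger0_norm ?sqrtC_ge0 ?ler0n.
have na (x : R[i]) a b : `|x| = 1 -> ((4 * a + b) %% 5 != 0)%N ->
    forall i m, `|(x *: ((S15_H R a) ^t* *m S15_H R b)) i m| = (sqrtC 5%:R)^-1.
  by move=> x1 ab i m; rewrite mxE normrM x1 mul1r norm_S15_block.
apply: norm_col_mx3; apply: norm_row_mx3 => //;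
  first [exact: n0 | by move=> i m; rewrite norm_S15_block
        | by apply: na; rewrite ?norm_zetaX ?norm_expi].
Qed.

Lemma S15_hadamard : complex_hadamard (S15 R).
Proof.
split; last by move=> i j k l; rewrite !norm_S15.
rewrite /S15 -S15_H0.
exact: (S15_gen_unitary (G_unitary 1) (G_unitary 2) (S15_H_unitary 0)
  (S15_H_unitary 3) (S15_H_unitary 4) erefl).
Qed.

End Facts.

(* Main.v *)
Require Import Defs.
From mathcomp Require Import all_boot all_order all_algebra.
From mathcomp Require Import complex classical_sets reals.
From mathcomp Require Import all_fingroup spectral ring zify.

(** Call two rows of a matrix cube-parallel if the cubes of their entries are
proportional; having two such rows is invariant under Hadamard equivalence.
Columns [k] and [k + 5] of a member of the Fourier family differ by the factors
[zeta 15 ^+ (5 * j)], which are cube roots of unity.  On the other hand, on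
the first five columns each row of [S15] is a constant times
[m |-> w ^+ (q * m ^ 2 + s * m)] with [w = zeta 5] (for the lower two block
rows by evaluation of quadratic Gauss sums), where the 15 pairs [(q, s)] are
distinct modulo 5; the same holds for the columns on the first five rows.  As 3
is prime to 5, cubing keeps these quadratic phases apart. *)

Set Implicit Arguments.
Unset Strict Implicit.
Unset Printing Implicit Defensive.

Import GRing.Theory Num.Theory.
Local Open Scope ring_scope.
Local Open Scope complex_scope.
Local Open Scope sesquilinear_scope.

(** Cross-multiplied, so that rescaling rows and columns multiplies both sides alike. *)
Definition cube_parallel (F : fieldType) (d : nat) (M : 'M[F]_d) : Prop :=
  exists j j', j != j' /\
    forall k k', (M j k * M j' k') ^+ 3 = (M j' k * M j k') ^+ 3.

Lemma hadamard_equivE (R : realType) d (H K : 'M[R[i]]_d) :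
  hadamard_equiv H K ->
  exists (u v : 'I_d -> R[i]) (s t : {perm 'I_d}),
    forall j k, H j k = u j * K (s j) (t k) * v k.
Proof.
case=> D1 [D2 [P1 [P2 [[u _ ->] [v _ ->] + + ->]]]].
move=> /is_perm_mxP[s ->] /is_perm_mxP[t ->].
(* Right multiplication by [perm_mx t] permutes columns by the inverse of [t]. *)
exists (u 0), (v 0), s, (t^-1)%g => j k.
rewrite mul_mx_diag mxE -[t in LHS]invgK -col_permE mxE.
by rewrite -mulmxA mul_diag_mx mxE -row_permE mxE.
Qed.

Lemma cube_parallel_equiv (R : realType) d (H K : 'M[R[i]]_d) :
  hadamard_equiv H K -> cube_parallel K -> cube_parallel H.
Proof.
case/hadamard_equivE=> u [v [s [t HE]]] [j [j' [jj' par]]].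
exists ((s^-1)%g j), ((s^-1)%g j'); split; first by rewrite (inj_eq perm_inj).
move=> k k'; rewrite !HE !permKV.
transitivity ((u ((s^-1)%g j) * u ((s^-1)%g j') * v k * v k') ^+ 3 *
  (K j (t k) * K j' (t k')) ^+ 3); first by ring.
by rewrite par; ring.
Qed.

Lemma cube_parallel_equiv_tr (R : realType) d (H K : 'M[R[i]]_d) :
  hadamard_equiv H K -> cube_parallel K^T -> cube_parallel H^T.
Proof.
case/hadamard_equivE=> u [v [s [t HE]]] [j [j' [jj' par]]].
exists ((t^-1)%g j), ((t^-1)%g j'); split; first by rewrite (inj_eq perm_inj).
move=> k k'; have := par (s k) (s k'); rewrite !mxE !HE !permKV => {}par.
transitivity ((v ((t^-1)%g j) * v ((t^-1)%g j') * u k * u k') ^+ 3 *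
  (K (s k) j * K (s k') j') ^+ 3); first by ring.
by rewrite par; ring.
Qed.

Lemma F15_family_cube_parallel (R : realType) (K : 'M[R[i]]_15) :
  F15_family R K -> cube_parallel K^T.
Proof.
(* Columns 0 and 5 agree modulo 5, so they carry the same phases from [r]. *)
case=> r [_ _ ->]; exists (inord 0), (inord 5); split.
  by apply/eqP => /(congr1 val); rewrite /= !inordK.
move=> k k'; rewrite !mxE !inordK //= !muln0 !expr0.
have w15 : zeta R 15 ^+ 15 = 1 by apply: zetaX.
have c l : (zeta R 15 ^+ (l * 5)) ^+ 3 = 1.
  by rewrite -exprM -mulnA mulnC exprM w15 expr1n.
rewrite !exprMn !c; ring.
Qed.

Lemma quadratic_not_cube_parallel (R : realType) (M : 'M[R[i]]_15)
    (q s : 'I_15 -> nat) :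
  (forall p k, M p k != 0) ->
  (forall p (m : 'I_15), (m < 5)%N ->
     M p m = M p ord0 * zeta R 5 ^+ (q p * m ^ 2 + s p * m)) ->
  (forall p p', q p = q p' %[mod 5] -> s p = s p' %[mod 5] -> p = p') ->
  ~ cube_parallel M.
Proof.
move=> M0 ME inj [p [p' [/eqP pp' par]]]; apply: pp'.
have cong (m : 'I_15) : (m < 5)%N ->
    (3 * (q p * m ^ 2 + s p * m) = 3 * (q p' * m ^ 2 + s p' * m) %[mod 5])%N.
  move=> m5; apply/eqP; rewrite -(eq_prim_root_expr (zeta_prim R _)) //.
  rewrite !(mulnC 3%N) !exprM; apply/eqP.
  apply: (mulfI (x := (M p ord0 * M p' ord0) ^+ 3)).
    by rewrite expf_neq0 // mulf_neq0.
  have := par m ord0; rewrite !(ME _ m) // => {}par.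
  rewrite -[LHS]exprMn -[RHS]exprMn.
  by move: par; rewrite !(mulrAC _ (zeta R 5 ^+ _)) [M p' _ * M p _]mulrC.
(* As 4 is -1 modulo 5, cancelling 3 leaves [q + s] and [q - s] modulo 5; these determine [q] and
   [s], since 2 is invertible. *)
have := cong (inord 1); have := cong (inord 4).
rewrite !inordK // => /(_ isT) c4 /(_ isT) c1.
apply: inj; lia.
Qed.

Lemma zeta5_congr (R : realType) m n :
  m = n %[mod 5] -> zeta R 5 ^+ m = zeta R 5 ^+ n.
Proof.
by move=> mn; apply/eqP; rewrite (eq_prim_root_expr (zeta_prim R _)) // mn.
Qed.

Lemma S15_expo_mod5 k : (k < 5)%N -> (S15_expo k = k ^ 2 %[mod 5])%N.
Proof. by case: k => [|[|[|[|[|]]]]]. Qed.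

(** A quadratic Gauss sum, because [S15_expo l] is [l ^ 2] modulo 5. *)
Definition gauss_sum (R : realType) (K n : nat) : R[i] :=
  \sum_(l < 5) zeta R 5 ^+ (S15_expo l * K + l * n).

(* Completing the square: as [4 = -1] modulo 5, [K^-1] is [- (4 * K)^-1]. *)
Lemma gauss_sumE (R : realType) (K q n : nat) : (K * q = 1 %[mod 5])%N ->
  gauss_sum R K n = gauss_sum R K 0 * zeta R 5 ^+ (q * n ^ 2).
Proof.
move=> Kq; rewrite /gauss_sum mulr_suml.
(* Modulo 5, 3 inverts 2 and [q] inverts [K]: the shift is [n / (2 * K)]. *)
pose h (l : 'I_5) : 'I_5 := inord ((l + 3 * q * n) %% 5)%N.
have hE l : h l = ((l + 3 * q * n) %% 5)%N :> nat by rewrite inordK // ltn_pmod.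
have h_inj : injective h.
  move=> l l' /(congr1 val); rewrite /= !hE => e; apply: val_inj => /=.
  have := ltn_ord l; have := ltn_ord l'; lia.
rewrite [RHS](reindex_inj h_inj).
apply: eq_bigr => l _; rewrite -exprD; apply: zeta5_congr.
have -> : (S15_expo (h l) * K + h l * 0 + q * n ^ 2 =
    (l + 3 * q * n) ^ 2 * K + q * n ^ 2 %[mod 5])%N.
  by rewrite muln0 addn0 -modnDml -modnMml S15_expo_mod5 // hE modnXm
    modnMml modnDml.
have -> : (S15_expo l * K + l * n = l ^ 2 * K + l * n %[mod 5])%N.
  by rewrite -modnDml -modnMml S15_expo_mod5 // modnMml modnDml.
(* Then [6 * (K * q)] is 1 and [9 * (K * q) + 1] is 0 modulo 5, with quotients [6 * a + 1] and
   [9 * a + 2]. *)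
have [a Ka] : exists a, (K * q = 5 * a + 1)%N by exists ((K * q) %/ 5)%N; lia.
have -> : ((l + 3 * q * n) ^ 2 * K + q * n ^ 2 =
    (l ^ 2 * K + l * n)
    + 5 * ((6 * a + 1) * (l * n) + (9 * a + 2) * (q * n ^ 2)))%N.
  transitivity (l ^ 2 * K + 6 * (K * q) * (l * n)
                + 9 * (K * q) * (q * n ^ 2) + q * n ^ 2)%N; first by ring.
  by rewrite Ka; ring.
by rewrite -[RHS]modnDmr modnMr addn0.
Qed.

(** Conjugation inverts [zeta R 5], that is, multiplies exponents by 4; so [4 * a + b] and
    [4 * i + m] stand for [b - a] and [m - i]. *)
Lemma S15_H_adj_mul (R : realType) (a b : nat) (i m : 'I_5) :
  ((S15_H R a) ^t* *m S15_H R b) i m =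
  5%:R^-1 * gauss_sum R (4 * a + b) (4 * i + m).
Proof.
rewrite mxE mulr_sumr; apply: eq_bigr => l _.
have trE (A : 'M[R[i]]_5) : (A ^t*) i l = Num.conj (A l i) by rewrite !mxE.
rewrite -sqrtC_inv2 trE !S15_HE !rmorphM /= conj_sqrtV rmorphXn /= conj_zeta.
have -> : (zeta R 5)^-1 = zeta R 5 ^+ 4.
  by apply: (mulfI (zeta_neq0 R 5)); rewrite mulfV ?zeta_neq0 // -exprS zetaX.
by rewrite -exprM mulrACA -exprD; congr (_ * _ ^+ _); lia.
Qed.

Lemma S15_neq0 (R : realType) p k : S15 R p k != 0.
Proof.
by rewrite -normr_eq0 norm_S15 mulf_neq0 // invr_neq0 // sqrtC_eq0 pnatr_eq0.
Qed.

(** By block row: 0 for the Fourier block, then the inverses modulo 5 of [4 * a] for [a = 1, 2]. *)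
Definition S15_row_quad (p : nat) := nth 0%N [:: 0; 4; 2]%N (p %/ 5).
(** In the lower blocks the multiplier is [8 * q] modulo 5, with [q] the quadratic coefficient. *)
Definition S15_row_lin (p : nat) := (nth 0%N [:: 1; 2; 1]%N (p %/ 5) * p)%N.

Lemma S15_rowE (R : realType) (p m : 'I_15) : (m < 5)%N ->
  S15 R p m = S15 R p ord0 *
    zeta R 5 ^+ (S15_row_quad p * m ^ 2 + S15_row_lin p * m).
Proof.
move=> m5; rewrite /S15_row_quad /S15_row_lin /S15 -S15_H0.
rewrite [in LHS]mxE [in RHS]mxE.
move: p m m5; change 15%N with (5 + (5 + 5))%N => p m m5.
have [m' ->] : exists m' : 'I_5, m = lshift (5 + 5) m'.
  by exists (Ordinal m5); apply: val_inj.
have -> : ord0 = lshift (5 + 5) (ord0 : 'I_5) by apply: val_inj.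
(* In [q * (4 * i + n) ^ 2] the [i ^ 2] term is absorbed by the value at [n = 0]. *)
have quad K q i n : (K * q = 1 %[mod 5])%N ->
    gauss_sum R K (4 * i + n) =
    gauss_sum R K (4 * i + 0) * zeta R 5 ^+ (q * n ^ 2 + 8 * q * i * n).
  move=> Kq; rewrite (gauss_sumE _ (4 * i + n) Kq).
  rewrite (gauss_sumE _ (4 * i + 0) Kq).
  by rewrite -mulrA -exprD; congr (_ * _ ^+ _); ring.
rewrite -!mulrA; congr (_ * _).
case: (split_ordP p) => [i ->|k ->].
  rewrite !col_mxEu !row_mxEl !S15_HE -mulrA -exprD; congr (_ * _ ^+ _).
  have -> : (lshift (5 + 5) i %/ 5 = 0)%N by rewrite divn_small /= ?ltn_ord.
  by rewrite /= !muln0 !add0n !mul1n.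
rewrite !col_mxEd; case: (split_ordP k) => i ->.
  rewrite !col_mxEu !row_mxEl !S15_H_adj_mul -mulrA; congr (_ * _).
  rewrite (@quad _ 4 i m') //; congr (_ * _); apply: zeta5_congr.
  have -> : (rshift 5 (lshift 5 i) %/ 5 = 1)%N.
    by have := ltn_ord i; rewrite /=; lia.
  by rewrite /=; lia.
rewrite !col_mxEd !row_mxEl !S15_H_adj_mul -mulrA; congr (_ * _).
rewrite (@quad _ 2 i m') //; congr (_ * _); apply: zeta5_congr.
have -> : (rshift 5 (rshift 5 i) %/ 5 = 2)%N.
  by have := ltn_ord i; rewrite /=; lia.
by rewrite /=; lia.
Qed.

(** The powers of [S15_D] in the first block row, whose blocks are [S15_H] at 0, 3 and 4. *)
Definition S15_col_quad (k : nat) := nth 0%N [:: 0; 3; 4]%N (k %/ 5).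

Lemma S15_colE (R : realType) (k l : 'I_15) : (l < 5)%N ->
  S15 R l k = S15 R ord0 k *
    zeta R 5 ^+ (S15_col_quad k * l ^ 2 + k * l).
Proof.
move=> l5; rewrite /S15_col_quad /S15 -S15_H0.
rewrite [in LHS]mxE [in RHS]mxE.
move: k l l5; change 15%N with (5 + (5 + 5))%N => k l l5.
have [l' ->] : exists l' : 'I_5, l = lshift (5 + 5) l'.
  by exists (Ordinal l5); apply: val_inj.
have -> : ord0 = lshift (5 + 5) (ord0 : 'I_5) by apply: val_inj.
rewrite -!mulrA; congr (_ * _); rewrite !col_mxEu.
case: (split_ordP k) => [i ->|j ->].
  rewrite !row_mxEl !S15_HE -mulrA -exprD; congr (_ * _); apply: zeta5_congr.
  have -> : (lshift (5 + 5) i %/ 5 = 0)%N by rewrite divn_small /= ?ltn_ord.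
  by rewrite /= !muln0 mulnC.
rewrite !row_mxEr; case: (split_ordP j) => i ->.
  rewrite !row_mxEl !S15_HE -mulrA -exprD; congr (_ * _); apply: zeta5_congr.
  have -> : (rshift 5 (lshift 5 i) %/ 5 = 1)%N.
    by have := ltn_ord i; rewrite /=; lia.
  change (S15_expo l' * 3 + l' * i = 3 * l' ^ 2 + (5 + i) * l' %[mod 5])%N.
  by have := S15_expo_mod5 (ltn_ord l'); lia.
rewrite !row_mxEr !S15_HE -mulrA -exprD; congr (_ * _); apply: zeta5_congr.
have -> : (rshift 5 (rshift 5 i) %/ 5 = 2)%N.
  by have := ltn_ord i; rewrite /=; lia.
change (S15_expo l' * 4 + l' * i = 4 * l' ^ 2 + (5 + (5 + i)) * l' %[mod 5])%N.
by have := S15_expo_mod5 (ltn_ord l'); lia.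
Qed.

Theorem proposition4 (R : realType) :
  (forall K, F15_family R K -> ~ hadamard_equiv (S15 R) K) /\
  (forall K, F15_family_tr R K -> ~ hadamard_equiv (S15 R) K).
Proof.
split=> [K /F15_family_cube_parallel par /cube_parallel_equiv_tr/(_ par)|].
  apply: (@quadratic_not_cube_parallel _ _ S15_col_quad id) => [p k|p m|p p'].
  - by rewrite mxE S15_neq0.
  - by rewrite ![(S15 R)^T _ _]mxE; apply: S15_colE.
  rewrite /S15_col_quad => eq es; apply: val_inj => /=.
  have := ltn_ord p; have := ltn_ord p'; move: eq es.
  (* The quadratic coefficient identifies the block, the linear one the position in it. *)
  case E: (p %/ 5)%N => [|[|[|]]] //=;
    case E': (p' %/ 5)%N => [|[|[|]]] //=; lia.
(* For the transposed family the cube-parallel lines are rows; the multipliers 1, 2, 1 are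
   invertible modulo 5. *)
move=> _ [K /F15_family_cube_parallel par <-] /cube_parallel_equiv/(_ par).
apply: (@quadratic_not_cube_parallel _ _ S15_row_quad S15_row_lin).
- exact: S15_neq0.
- by move=> p m; apply: S15_rowE.
move=> p p'; rewrite /S15_row_quad /S15_row_lin => eq es; apply: val_inj => /=.
have := ltn_ord p; have := ltn_ord p'; move: eq es.
case E: (p %/ 5)%N => [|[|[|]]] //=;
    case E': (p' %/ 5)%N => [|[|[|]]] //=; lia.
Qed.
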